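(* Let $\mathcal{Q}=(Q,\&)$ be a quantale. If for every $\mathcal{Q}$-ordered set $A$ all forward Cauchy ideals of $A$ are irreducible ideals of $A$, then $\mathcal{Q}$ is dually meet continuous.
   Context: A quantale $\mathcal{Q}=(Q,\&)$ is always assumed integral and commutative: $Q$ is a complete lattice (bottom $0$, top $1$) and $\&$ is a commutative associative operation on $Q$ with unit $1$ that distributes over arbitrary joins. Its implication $\to$ is defined by $p\&q\le r\iff q\le p\to r$. A complete lattice $L$ is meet continuous if $a\wedge\bigvee D=\bigvee_{d\in D}(a\wedge d)$ for all $a\in L$ and all directed $D\subseteq L$; it is dually meet continuous if its opposite is meet continuous. $\mathcal{Q}$ is dually meet continuous if the lattice $Q$ is. A $\mathcal{Q}$-ordered set is a set $A$ with a map $A(-,-):A\times A\to Q$ such that $A(x,x)=1$ and $A(y,z)\&A(x,y)\le A(x,z)$ for all $x,y,z\in A$. A fuzzy lower set of $A$ is a map $\phi:A\to Q$ with $\phi(y)\&A(x,y)\le\phi(x)$ for all $x,y$. Joins of maps $A\to Q$ are pointwise. For fuzzy lower sets, $\mathrm{sub}_A(\phi_1,\phi_2)=\bigwedge_{x\in A}(\phi_1(x)\to\phi_2(x))$. A map $\lambda:A\to Q$ is inhabited if $\bigvee_{a\in A}\lambda(a)=1$. A net $\{x_i\}$ in $A$ is forward Cauchy if $\bigvee_i\bigwedge_{i\le j\le k}A(x_j,x_k)=1$. A fuzzy lower set $\phi$ of $A$ is a forward Cauchy ideal if $\phi=\bigvee_i\bigwedge_{j\ge i}A(-,x_j)$ for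 some forward Cauchy net $\{x_i\}$ in $A$. A fuzzy lower set $\phi$ is an irreducible ideal if it is inhabited and $\mathrm{sub}_A(\phi,\phi_1\vee\phi_2)=\mathrm{sub}_A(\phi,\phi_1)\vee\mathrm{sub}_A(\phi,\phi_2)$ for all fuzzy lower sets $\phi_1,\phi_2$ of $A$. *)

(* Defs.v *)
From HB Require Import structures.
From mathcomp Require Import all_boot all_order.
From mathcomp Require Import boolp classical_sets.

Set Implicit Arguments.
Unset Strict Implicit.
Unset Printing Implicit Defensive.

Import Order.TTheory.
Local Open Scope classical_set_scope.
Local Open Scope order_scope.

(* The bounds \bot and \top of a tbLatticeType need not be distinct, so the
   one-element lattice is allowed. *)
HB.mixin Record isComplete d T of Order.TBLattice d T := {
  supremums_neq0 : forall A : set T, supremums A !=set0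
}.

#[short(type="completeLatticeType")]
HB.structure Definition CompleteLattice d :=
  {T of Order.TBLattice d T & isComplete d T}.

(* [supremum x0] and [infimum x0] return x0 on the empty set. *)
Definition csup d (L : completeLatticeType d) (A : set L) : L :=
  supremum \bot A.

Definition cinf d (L : completeLatticeType d) (A : set L) : L :=
  infimum \top A.

Lemma csupP d (L : completeLatticeType d) (A : set L) (y : L) :
  csup A <= y <-> ubound A y.
Proof.
rewrite /csup /supremum; case: ifPn => [/eqP ->|_]; first by split => [_ t []|_]; rewrite ?le0x.
have [x sx] := supremums_neq0 A.
case: xgetP => [z _ [ubz lbz]|/(_ x sx)//]; split => [zy t At|/lbz//].
exact: le_trans (ubz _ At) zy.
Qed.

Lemma infimums_neq0 d (L : completeLatticeType d) (A : set L) :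
  infimums A !=set0.
Proof.
have [x [ubx lbx]] := supremums_neq0 (lbound A).
exists x; split => [a Aa|y /ubx//].
by apply: lbx => y; apply.
Qed.

Lemma cinfP d (L : completeLatticeType d) (A : set L) (y : L) :
  y <= cinf A <-> lbound A y.
Proof.
rewrite /cinf /infimum; case: ifPn => [/eqP ->|_]; first by split => [_ t []|_]; rewrite ?lex1.
have [x ix] := infimums_neq0 A.
case: xgetP => [z _ [lbz ubz]|/(_ x ix)//]; split => [yz t At|/ubz//].
exact: le_trans yz (lbz _ At).
Qed.

Lemma dual_supremums_neq0 d (L : completeLatticeType d) (A : set L^d) :
  supremums A !=set0.
Proof. exact: (@infimums_neq0 d L A). Qed.

HB.instance Definition _ d (L : completeLatticeType d) :=
  isComplete.Build (Order.dual_display d) L^d (@dual_supremums_neq0 d L).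

Definition directed (T : Type) (R : T -> T -> Prop) (D : set T) : Prop :=
  D !=set0 /\
  forall x y, D x -> D y -> exists z, [/\ D z, R x z & R y z].

Definition meet_continuous d (L : completeLatticeType d) : Prop :=
  forall (a : L) (D : set L), directed (fun x y => x <= y) D ->
    a `&` csup D = csup [set a `&` x | x in D].

Definition dually_meet_continuous d (L : completeLatticeType d) : Prop :=
  meet_continuous L^d.

HB.mixin Record isQuantale d Q of CompleteLattice d Q := {
  qmul : Q -> Q -> Q;
  qmulC : commutative qmul;
  qmulA : associative qmul;
  qmul1x : left_id \top qmul;
  qmul_csup : forall (p : Q) (A : set Q),
    qmul p (csup A) = csup [set qmul p q | q in A]
}.

#[short(type="quantaleType")]
HB.structure Definition Quantale d :=
  {Q of CompleteLattice d Q & isQuantale d Q}.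

Definition qimp d (Q : quantaleType d) (p r : Q) : Q :=
  csup [set q | qmul p q <= r].

Lemma qimpP d (Q : quantaleType d) (p q r : Q) :
  qmul p q <= r <-> q <= qimp p r.
Proof.
split=> [pqr|qpr]; first by move/csupP: (lexx (qimp p r)); apply.
have pimp : qmul p (qimp p r) <= r.
  by rewrite qmul_csup; apply/csupP => _ [s ps <-].
apply: le_trans pimp; have -> : qimp p r = csup [set q; qimp p r].
  apply/le_anti/andP; split; last by apply/csupP => x [->|->].
  by move/csupP: (lexx (csup [set q; qimp p r])); apply; right.
rewrite qmul_csup; move/csupP: (lexx (csup [set qmul p x | x in [set q; qimp p r]])).
by apply; exists q => //; left.
Qed.

Record qOrderedSet d (Q : quantaleType d) := QOrderedSet {
  qcarrier :> Type;
  qhom : qcarrier -> qcarrier -> Q;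
  qhom_refl : forall x, qhom x x = \top;
  qhom_trans : forall x y z, qmul (qhom y z) (qhom x y) <= qhom x z
}.

Definition fuzzy_lower_set d (Q : quantaleType d) (A : qOrderedSet Q)
    (phi : A -> Q) : Prop :=
  forall x y : A, qmul (phi y) (qhom x y) <= phi x.

Definition fuzzy_join d (Q : quantaleType d) (A : qOrderedSet Q)
    (phi psi : A -> Q) : A -> Q :=
  fun x => phi x `|` psi x.

Definition fuzzy_sub d (Q : quantaleType d) (A : qOrderedSet Q)
    (phi psi : A -> Q) : Q :=
  cinf (range (fun x : A => qimp (phi x) (psi x))).

Definition inhabited_map d (Q : quantaleType d) (A : qOrderedSet Q)
    (phi : A -> Q) : Prop :=
  csup (range phi) = \top.

Record net (A : Type) := Net {
  net_index : Type;
  net_le : net_index -> net_index -> Prop;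
  net_refl : forall i, net_le i i;
  net_trans : forall i j k, net_le i j -> net_le j k -> net_le i k;
  net_directed : directed net_le [set: net_index];
  net_val :> net_index -> A
}.

Definition forward_cauchy d (Q : quantaleType d) (A : qOrderedSet Q)
    (x : net A) : Prop :=
  csup (range (fun i : net_index x =>
    cinf [set qhom (x jk.1) (x jk.2) |
          jk in [set jk | net_le i jk.1 /\ net_le jk.1 jk.2]])) = \top.

Definition net_ideal d (Q : quantaleType d) (A : qOrderedSet Q)
    (x : net A) : A -> Q :=
  fun a => csup (range (fun i : net_index x =>
    cinf [set qhom a (x j) | j in [set j | net_le i j]])).

Definition forward_cauchy_ideal d (Q : quantaleType d) (A : qOrderedSet Q)
    (phi : A -> Q) : Prop :=
  fuzzy_lower_set phi /\
  exists x : net A, forward_cauchy x /\ phi = net_ideal x.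

Definition irreducible_ideal d (Q : quantaleType d) (A : qOrderedSet Q)
    (phi : A -> Q) : Prop :=
  [/\ fuzzy_lower_set phi, inhabited_map phi &
      forall phi1 phi2 : A -> Q, fuzzy_lower_set phi1 -> fuzzy_lower_set phi2 ->
        fuzzy_sub phi (fuzzy_join phi1 phi2) =
        fuzzy_sub phi phi1 `|` fuzzy_sub phi phi2].

(* Main.v *)
Require Import Defs.
From mathcomp Require Import all_boot all_order.
From mathcomp Require Import boolp classical_sets.

(** Let [D] be a down-directed subset of [Q].  Regard [D], with the reverse of
    the order of [Q], as a [Q]-ordered set with values in [{\bot, \top}].  Its
    fuzzy lower sets are the monotone maps [D -> Q], among them the inclusion
    and the constants.  The identity of [D] is an increasing net, hence forward
    Cauchy, and it is cofinal in [D], so the forward Cauchy ideal it generates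
    is the constant [\top] ([top_forward_cauchy_ideal]).  The degree to which
    the constant [\top] is contained in [psi] is the infimum of the values of
    [psi] ([fuzzy_sub_top]).  Therefore the irreducibility of the constant
    [\top], tested on the constant [a] and on the inclusion of [D], reads
    [inf (a \/ d) = a \/ inf D], which is dual meet continuity. *)

Set Implicit Arguments.
Unset Strict Implicit.
Unset Printing Implicit Defensive.

Import Order.TTheory.
Local Open Scope classical_set_scope.
Local Open Scope order_scope.

Section CompleteLattice.
Context {d : Order.disp_t} {L : completeLatticeType d}.
Implicit Types (A : set L) (x : L).

Lemma csup_ub A x : A x -> x <= csup A.
Proof. by move=> Ax; have /csupP := lexx (csup A); apply. Qed.

Lemma cinf_lb A x : A x -> cinf A <= x.
Proof. by move=> Ax; have /cinfP := lexx (cinf A); apply. Qed.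

Lemma cinf_cst (T : Type) (t : T) x : cinf (range (fun _ : T => x)) = x.
Proof.
apply/le_anti/andP; split; first by apply: cinf_lb; exists t.
by apply/cinfP => _ [_ _ <-].
Qed.

End CompleteLattice.

Lemma csup_dual d (L : completeLatticeType d) (A : set L^d) : csup A = cinf (A : set L).
Proof.
apply/le_anti/andP; split; first by apply/csupP => x Ax; exact: cinf_lb.
by apply/(@cinfP d L) => x Ax; exact: (@csup_ub _ L^d A).
Qed.


Section Crisp.
Context {d : Order.disp_t} {Q : quantaleType d}.

Lemma qmulx0 (p : Q) : qmul p \bot = \bot.
Proof. by apply/le_anti; rewrite le0x andbT; apply/qimpP/le0x. Qed.

Lemma qmulx1 (p : Q) : qmul p \top = p.
Proof. by rewrite qmulC qmul1x. Qed.

Lemma qimp1x (r : Q) : qimp \top r = r.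
Proof.
apply/le_anti/andP; split; last by apply/qimpP; rewrite qmul1x.
by rewrite -[leLHS]qmul1x; exact/qimpP.
Qed.

Lemma fuzzy_sub_top (A : qOrderedSet Q) (psi : A -> Q) :
  fuzzy_sub (fun=> \top) psi = cinf (range psi).
Proof. by rewrite /fuzzy_sub; under eq_fun do rewrite qimp1x. Qed.

Context {T : Type} (R : rel T) (Rxx : reflexive R) (Rtr : transitive R).

Let hom (x y : T) : Q := if R x y then \top else \bot.

Fact crisp_refl x : hom x x = \top.
Proof. by rewrite /hom Rxx. Qed.

Fact crisp_trans x y z : qmul (hom y z) (hom x y) <= hom x z.
Proof.
rewrite /hom; case: (boolP (R x y)) => [xy|_]; last by rewrite qmulx0 le0x.
case: (boolP (R y z)) => [yz|_]; last by rewrite qmulx1 le0x.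
by rewrite (Rtr xy yz) lex1.
Qed.

Definition crisp : qOrderedSet Q := QOrderedSet crisp_refl crisp_trans.

Lemma crisp_lower_set (phi : T -> Q) :
  (forall x y, R x y -> phi y <= phi x) -> @fuzzy_lower_set d Q crisp phi.
Proof.
move=> anti x y /=; rewrite /hom.
by case: ifPn => [/anti|_]; rewrite ?qmulx1 // qmulx0 le0x.
Qed.

Context (Rdir : directed R [set: T]).

Definition identity_net : net crisp :=
  @Net crisp T R Rxx (fun i j k => @Rtr j i k) Rdir id.

Lemma identity_net_forward_cauchy : forward_cauchy identity_net.
Proof.
have [[t _] _] := Rdir.
apply/le_anti; rewrite lex1 /=; apply: le_trans (csup_ub _); last first.
  by exists t.
by apply/cinfP => _ [[j k] [_ /= jk] <-]; rewrite /hom jk.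
Qed.

(** At a point [a], the terms of the net from the index [a] on all lie above
    [a], so the join over the indices already attains [\top] there. *)
Lemma net_ideal_identity_net : net_ideal identity_net = fun=> \top.
Proof.
apply/funext => a; apply/le_anti; rewrite lex1 /=.
apply: le_trans (csup_ub _); last by exists a.
by apply/cinfP => _ [j /= aj <-]; rewrite /hom aj.
Qed.

Lemma top_forward_cauchy_ideal :
  @forward_cauchy_ideal d Q crisp (fun=> \top).
Proof.
split; first exact: crisp_lower_set.
exists identity_net; split; first exact: identity_net_forward_cauchy.
by rewrite net_ideal_identity_net.
Qed.

End Crisp.

Theorem proposition3p12 (d : Order.disp_t) (Q : quantaleType d) :
  (forall (A : qOrderedSet Q) (phi : A -> Q),
     forward_cauchy_ideal phi -> irreducible_ideal phi) ->
  dually_meet_continuous Q.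
Proof.
move=> fci_irr a D [[x0 Dx0] Ddir].
pose T := {x : Q | D x}; pose R : rel T := fun x y => sval y <= sval x.
have Rxx : reflexive R by move=> x; exact: lexx.
have Rtr : transitive R by move=> y x z xy yz; exact: le_trans yz xy.
have Rdir : directed R [set: T].
  split=> [|[x Dx] [y Dy] _ _]; first by exists (exist _ x0 Dx0).
  by have [z [Dz xz yz]] := Ddir x y Dx Dy; exists (exist _ z Dz).
have [_ _ irr] := fci_irr _ _ (top_forward_cauchy_ideal Rxx Rtr Rdir).
have := irr (fun=> a) sval (crisp_lower_set (fun _ _ _ => lexx a))
  (crisp_lower_set (fun _ _ xy => xy)).
rewrite !fuzzy_sub_top (cinf_cst (exist _ x0 Dx0 : T)).
have -> : range (sval : T -> Q) = D.
  by apply/seteqP; split=> [_ [[x Dx] _ <-]|x Dx] //; exists (exist _ x Dx).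
have -> : range (@fuzzy_join d Q (crisp Rxx Rtr) (fun=> a) sval) =
          [set (a : Q) `|` x | x in D].
  apply/seteqP; split=> [_ [[x Dx] _ <-]|_ [x Dx <-]]; first by exists x.
  by exists (exist _ x Dx).
by rewrite !csup_dual => ->.
Qed.
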